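(* Let $Y$ be a Banach space, let $A$ be a proper closed subset of $Y$, and let $k\in-0^+A\setminus\{0\}$. Then the following three conditions are equivalent: (i) $\varphi_{A,k}$ is finite-valued and Lipschitz; (ii) $\varphi_{0^+A,k}$ is finite-valued and Lipschitz; (iii) $k\in-\operatorname{int}0^+A$. If $k\in-\operatorname{int}0^+A$, then each Lipschitz constant of $\varphi_{0^+A,k}$ is also a Lipschitz constant of $\varphi_{A,k}$.
   Context: Vector spaces are real. ''Proper subset of $Y$'' means nonempty and different from $Y$. $0^+A=\{u\in Y\mid a+tu\in A\ \forall a\in A,\ \forall t\ge0\}$ is the recession cone. $\nu$ is a symbolic value not in $\overline{\mathbb{R}}=\mathbb{R}\cup\{\pm\infty\}$, and $\inf\emptyset:=\nu$. For a set $M\subseteq Y$ and $k\in Y\setminus\{0\}$, $\varphi_{M,k}:Y\to\overline{\mathbb{R}}\cup\{\nu\}$ is defined by $\varphi_{M,k}(y)=\inf\{t\in\mathbb{R}\mid y\in tk+M\}$. It is finite-valued if $\varphi_{M,k}(y)\in\mathbb{R}$ for all $y\in Y$. *)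

(* Defs.v *)
From HB Require Import structures.
From mathcomp Require Import all_boot all_order all_algebra.
From mathcomp Require Import all_classical all_reals all_analysis.

Set Implicit Arguments.
Unset Strict Implicit.
Unset Printing Implicit Defensive.

Import Order.TTheory GRing.Theory Num.Theory.
Import numFieldNormedType.Exports.

Local Open Scope classical_set_scope.
Local Open Scope ring_scope.

Definition proper_subset (T : Type) (A : set T) : Prop :=
  A !=set0 /\ A <> setT.

Definition opp_set (V : zmodType) (B : set V) : set V := [set - x | x in B].

Definition recession_cone (R : realType) (V : lmodType R) (A : set V) : set V :=
  [set u | forall a, A a -> forall t : R, 0 <= t -> A (a + t *: u)].

(* The codomain [option (\bar R)] is the extended real line with the extra
   symbolic value nu, encoded as [None]. *)
Definition inf_nu (R : realType) (S : set R) : option (\bar R) :=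
  if `[< S = set0 >] then None else Some (ereal_inf (EFin @` S)).

Definition gerstewitz (R : realType) (V : lmodType R) (M : set V) (k : V)
    (y : V) : option (\bar R) :=
  inf_nu [set t : R | [set t *: k + m | m in M] y].

Definition finite_valued (R : realType) (T : Type)
    (phi : T -> option (\bar R)) : Prop :=
  forall y, exists r : R, phi y = Some r%:E.

(* A Lipschitz constant is only meaningful for a finite-valued [phi], i.e. one
   that comes from a (then unique) real-valued function [f]. No sign is imposed
   on [L]: on a nonzero space the inequality forces 0 <= L. *)
Definition lipschitz_constant (R : realType) (V : normedModType R)
    (phi : V -> option (\bar R)) (L : R) : Prop :=
  exists f : V -> R^o, (forall y, phi y = Some (f y)%:E) /\ L.-lipschitz f.

Definition is_lipschitz (R : realType) (V : normedModType R)
    (phi : V -> option (\bar R)) : Prop :=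
  exists L : R, lipschitz_constant phi L.

(* Main.v *)
Require Import Defs.
From HB Require Import structures.
From mathcomp Require Import all_boot all_order all_algebra.
From mathcomp Require Import all_classical all_reals all_analysis.
From mathcomp Require Import lra.

Set Implicit Arguments.
Unset Strict Implicit.
Unset Printing Implicit Defensive.

Import Order.TTheory GRing.Theory Num.Theory.
Import numFieldNormedType.Exports.

Local Open Scope classical_set_scope.
Local Open Scope ring_scope.

(** Write C for the recession cone of A. Since - k lies in C and A is closed,
    the set of t with y - t k in A is a closed upper ray, so a real value r of
    the functional at y is characterised by: y - t k lies in A iff r <= t
    ([gerstewitz_sublevel]). Every claim about the functional thereby becomes
    a claim about membership in A.

    The bridge is the condition

      (+)   u - L |u| k lies in C for every u,

    a quantitative form of - k being interior to C.
    - Interior implies (+) for some L: rescale u into a ball around - k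
      ([interior_recession_cone_absorbs]).
    - (+) implies that the functional of A is L-Lipschitz once it is finite:
      adding (x - y) - L |x - y| k to the point y - f(y) k of A stays in A
      ([gerstewitz_lipschitz_transfer]). Finiteness comes from (+) too, since
      large moves along - k reach A from any point, and large moves along k
      leave A because A is not everything ([interior_gerstewitz_fin]).
    - Any Lipschitz constant L of the functional of C satisfies (+), as that
      functional is nonpositive at 0 ([lipschitz_constant_cone]). This is why
      Lipschitz constants pass from C to A.
    - Conversely, moving from a in A by t v with v near - k lowers the
      functional by t up to an error t L |v + k| <= t, so the point stays in
      A and v is in C ([lipschitz_interior_recession_cone]).

    Finally C is itself a proper closed set equal to its own recession cone,
    so the equivalence of [ii] and [iii] is that of [i] and [iii] for C. *)

Lemma opp_setP (V : zmodType) (B : set V) (v : V) : opp_set B v <-> B (- v).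
Proof.
split; first by case=> x Bx <-; rewrite opprK.
by move=> Bv; exists (- v); rewrite ?opprK.
Qed.

(** * Recession cones *)

Section RecessionCone.
Variables (R : realType) (V : lmodType R) (A : set V).
Implicit Types (a u v : V) (t : R).

Lemma recession_cone0 : recession_cone A 0.
Proof. by move=> a Aa t _; rewrite scaler0 addr0. Qed.

Lemma recession_coneZ t u :
  0 <= t -> recession_cone A u -> recession_cone A (t *: u).
Proof.
by move=> t0 Cu a Aa s s0; rewrite scalerA; apply: Cu => //; apply: mulr_ge0.
Qed.

Lemma recession_coneD u v :
  recession_cone A u -> recession_cone A v -> recession_cone A (u + v).
Proof.
by move=> Cu Cv a Aa t t0; rewrite scalerDr addrA; apply: Cv => //; apply: Cu.
Qed.

Lemma recession_cone_shift a u :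
  A a -> recession_cone A u -> A (a + u).
Proof. by move=> Aa Cu; rewrite -[u]scale1r; apply: Cu. Qed.

Lemma recession_cone_proper :
  proper_subset A -> proper_subset (recession_cone A).
Proof.
case=> -[a Aa] AT; split; first by exists 0; apply: recession_cone0.
move=> CT; apply: AT; rewrite -subTset => y _.
by rewrite -(subrKC a y); apply: recession_cone_shift => //; rewrite CT.
Qed.

End RecessionCone.

(** A convex cone containing 0 is its own set of recession directions. Hence
    results relating a set to its recession cone also apply with the cone in
    the role of the set. *)
Lemma recession_coneK (R : realType) (V : lmodType R) (A : set V) :
  recession_cone (recession_cone A) = recession_cone A.
Proof.
apply/seteqP; split=> u Cu.
  rewrite -[u]add0r; apply: recession_cone_shift => //.
  exact: recession_cone0.
by move=> v Cv t t0; apply: recession_coneD => //; apply: recession_coneZ.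
Qed.

Lemma recession_cone_closed (R : realType) (V : normedModType R) (A : set V) :
  closed A -> closed (recession_cone A).
Proof.
move=> cA u Cu a Aa t t0.
apply: (@preimage_closed V V (fun v => a + t *: v) A _ cA).
  by move=> v _; apply: cvgD; [exact: cvg_cst | apply: cvgZr; exact: cvg_id].
by apply: closure_subset Cu => v Cv; apply: Cv.
Qed.

(** * Finite values of the Gerstewitz functional *)

Lemma gerstewitz_setE (R : realType) (V : lmodType R) (M : set V) (k y : V) :
  [set t : R | [set t *: k + m | m in M] y] = [set t | M (y - t *: k)].
Proof.
apply/seteqP; split=> t /=; first by case=> m Mm <-; rewrite addrC addKr.
by move=> Mt; exists (y - t *: k) => //; rewrite addrC subrK.
Qed.

Lemma gerstewitz_fin (R : realType) (V : lmodType R) (M : set V) (k y : V) :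
  (exists t : R, M (y - t *: k)) ->
  (exists b : R, forall t : R, M (y - t *: k) -> b <= t) ->
  exists r : R, gerstewitz M k y = Some r%:E.
Proof.
move=> [t Mt] [b lb]; exists (inf [set t | M (y - t *: k)]).
rewrite /gerstewitz /inf_nu gerstewitz_setE asboolF.
  by rewrite ereal_inf_EFin//; [exists b | exists t].
by apply/eqP/set0P; exists t.
Qed.

(** The infimum is attained, because the ray of admissible t is the preimage
    of the closed set M under a continuous map; and it is a ray because
    - k is a recession direction. *)
Lemma gerstewitz_sublevel (R : realType) (V : normedModType R) (M : set V)
    (k y : V) (r : R) :
  closed M -> recession_cone M (- k) -> gerstewitz M k y = Some r%:E ->
  forall t : R, M (y - t *: k) <-> r <= t.
Proof.
move=> cM Ck; rewrite /gerstewitz /inf_nu gerstewitz_setE.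
case: asboolP => // _ [infE] t; split=> [Mt | rt].
  by rewrite -lee_fin -infE; apply: ereal_inf_lbound; exists t.
have up s s' : s <= s' -> M (y - s *: k) -> M (y - s' *: k).
  move=> ss' Ms.
  have -> : y - s' *: k = (y - s *: k) + (s' - s) *: (- k).
    by rewrite scalerN scalerBl opprB addrA subrK.
  by apply: Ck => //; rewrite subr_ge0.
apply: (up r) => //.
have cS : closed [set s : R | M (y - s *: k)].
  apply: (@preimage_closed R V (fun s => y - s *: k) M _ cM) => s _.
  by apply: cvgB; [exact: cvg_cst | apply: cvgZl; exact: cvg_id].
apply: cS => B /nbhs_ballP[e /= e0 eB].
have [|_ [s Ms <-]] :=
  @lb_ereal_inf_adherent _ (EFin @` [set t | M (y - t *: k)]) _ e0.
  by rewrite infE.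
rewrite infE -EFinD lte_fin => sre.
have rs : r <= s by rewrite -lee_fin -infE; apply: ereal_inf_lbound; exists s.
exists s; split=> //; apply: eB; rewrite /ball/= distrC ger0_norm ?subr_ge0//.
by rewrite ltrBlDl.
Qed.

(** * Lipschitz continuity and the interior of the recession cone *)

Section Lipschitz.
Variables (R : realType) (V : normedModType R).
Implicit Types (A : set V) (k u y : V) (L : R).

(** By symmetry in the two points, the two-sided Lipschitz bound reduces to a
    one-sided one, which is the form that sublevel sets produce. *)
Lemma gerstewitz_lipschitzP A k L :
  lipschitz_constant (gerstewitz A k) L <->
  exists f : V -> R, (forall y, gerstewitz A k y = Some (f y)%:E) /\
    forall x y, f x <= f y + L * `|x - y|.
Proof.
split=> -[f [fE fL]]; exists f; split=> //.
  move=> x y; rewrite -lerBlDl; apply: le_trans (fL (x, y) _) => //.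
  by rewrite /= ler_norm.
move=> [x y] _ /=; rewrite ler_norml lerBlDl fL andbT.
by rewrite lerNl opprB lerBlDl distrC fL.
Qed.

(** A ball of radius r around - k in the cone contains - k + u' whenever
    |u'| < r; take u' a multiple of u of norm r / 2 and rescale. *)
Lemma interior_recession_cone_absorbs A k :
  interior (recession_cone A) (- k) ->
  exists2 L, 0 < L & forall u, recession_cone A (u - (L * `|u|) *: k).
Proof.
move=> /nbhs_ballP[r /= r0 rC]; exists (2 / r); first by rewrite divr_gt0.
move=> u; have [->|u0] := eqVneq u 0.
  by rewrite normr0 mulr0 scale0r subr0; apply: recession_cone0.
have nu : 0 < `|u| by rewrite normr_gt0.
have q0 : 0 < 2 / r * `|u| by rewrite mulr_gt0// divr_gt0.
have -> : u - (2 / r * `|u|) *: k =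
    (2 / r * `|u|) *: (- k + (2 / r * `|u|)^-1 *: u).
  by rewrite scalerDr scalerA divff ?gt_eqF// scale1r scalerN addrC.
apply: recession_coneZ; first exact: ltW.
apply: rC; rewrite -ball_normE /= opprD addNKr normrN normrZ.
rewrite gtr0_norm ?invr_gt0// invfM -mulrA mulVf ?gt_eqF// mulr1.
rewrite invf_div; lra.
Qed.

(** From a point a of A, the cone reaches y - t k for large t. If y - t k
    were in A for t below - L |z - y|, then the cone would in the same way
    carry it to z; choosing z outside A gives the lower bound. *)
Lemma interior_gerstewitz_fin A k :
  proper_subset A -> interior (recession_cone A) (- k) ->
  finite_valued (gerstewitz A k).
Proof.
move=> [[a Aa] AT] intk y.
have [L L0 absL] := interior_recession_cone_absorbs intk.
apply: gerstewitz_fin.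
  exists (L * `|y - a|); rewrite -(subrKC a y) -addrA subrKC.
  exact: recession_cone_shift.
have [z nAz] : exists z, ~ A z.
  by apply/existsNP => AA; apply: AT; apply/seteqP; split.
exists (- (L * `|z - y|)) => t At; rewrite leNgt; apply/negP => tlt.
apply: nAz.
have -> : z = (y - t *: k) +
    ((z - y - (L * `|z - y|) *: k) + (- (t + L * `|z - y|)) *: (- k)).
  rewrite scaleNr scalerN opprK scalerDl [t *: k + _]addrC [z - y - _ + _]addrA.
  rewrite subrK.
  by rewrite [z - y + _]addrC addrA subrK subrKC.
apply: recession_cone_shift => //; apply: recession_coneD => //.
apply: recession_coneZ; [lra | exact: interior_subset].
Qed.

(** From the point y - f(y) k of A, the recession direction
    (x - y) - L |x - y| k leads to x - (f(y) + L |x - y|) k, which is thus in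
    A: so f(x) is at most f(y) + L |x - y|. *)
Lemma gerstewitz_lipschitz_transfer A k L :
  closed A -> recession_cone A (- k) ->
  finite_valued (gerstewitz A k) ->
  (forall u, recession_cone A (u - (L * `|u|) *: k)) ->
  lipschitz_constant (gerstewitz A k) L.
Proof.
move=> cA Ck /choice[f fE] CL; apply/gerstewitz_lipschitzP; exists f.
split=> // x y; apply/(gerstewitz_sublevel cA Ck (fE x)).
have -> : x - (f y + L * `|x - y|) *: k =
    (y - f y *: k) + ((x - y) - (L * `|x - y|) *: k).
  rewrite scalerDl opprD !addrA; congr (_ - _).
  by rewrite -[y - _ + x]addrA [RHS]addrC addKr addrC.
apply: recession_cone_shift => //.
by apply/(gerstewitz_sublevel cA Ck (fE y)).
Qed.

(** The cone contains 0, so its functional is at most 0 there and at most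
    L |u| at u; as the infimum is attained, u - L |u| k is in the cone. *)
Lemma lipschitz_constant_cone A k L :
  closed A -> recession_cone A (- k) ->
  lipschitz_constant (gerstewitz (recession_cone A) k) L ->
  forall u, recession_cone A (u - (L * `|u|) *: k).
Proof.
move=> cA Ck /gerstewitz_lipschitzP[f [fE fL]] u.
have level y t : recession_cone A (y - t *: k) <-> f y <= t.
  apply: gerstewitz_sublevel (fE y) t; first exact: recession_cone_closed.
  by rewrite recession_coneK.
apply/level; have f0 : f 0 <= 0.
  by apply/level; rewrite scale0r subr0; apply: recession_cone0.
by have := fL u 0; rewrite subr0; lra.
Qed.

Lemma interior_gerstewitz_lipschitz A k :
  proper_subset A -> closed A -> interior (recession_cone A) (- k) ->
  finite_valued (gerstewitz A k) /\ is_lipschitz (gerstewitz A k).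
Proof.
move=> pA cA intk; have fin := interior_gerstewitz_fin pA intk; split=> //.
have [L _ absL] := interior_recession_cone_absorbs intk; exists L.
by apply: gerstewitz_lipschitz_transfer => //; apply: interior_subset.
Qed.

(** Along t (- k) the functional drops by t, and replacing - k by v costs at
    most t L |v + k|. On the ball |v + k| < 1 / (|L| + 1) the cost does not
    exceed the drop, so all rays from A in direction v stay in A. *)
Lemma lipschitz_interior_recession_cone A k :
  closed A -> recession_cone A (- k) -> is_lipschitz (gerstewitz A k) ->
  interior (recession_cone A) (- k).
Proof.
move=> cA Ck [L /gerstewitz_lipschitzP[f [fE fL]]].
have level y t := gerstewitz_sublevel cA Ck (fE y) t.
(* The radius 1 / (|L| + 1) makes sense for L = 0 as well. *)
have L1 : 0 < `|L| + 1 by rewrite ltr_wpDl.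
apply/nbhs_ballP; exists (`|L| + 1)^-1; first by rewrite /= invr_gt0.
move=> v; rewrite -ball_normE /= distrC => vk a Aa t t0.
have Lvk : L * `|v + k| <= 1.
  rewrite opprK in vk; apply: le_trans (_ : (`|L| + 1) * `|v + k| <= 1).
    by apply: ler_wpM2r => //; apply: le_trans (ler_norm L) _; rewrite lerDl.
  by rewrite -ler_pdivlMl// mulr1 ltW.
have fa : f (a - t *: k) <= - t.
  by apply/level; rewrite scaleNr opprK subrK.
have /level : f (a + t *: v) <= 0.
  apply: le_trans (fL _ (a - t *: k)) _.
  have -> : a + t *: v - (a - t *: k) = t *: (v + k).
    by rewrite opprB addrC addrA subrK scalerDr addrC.
  rewrite normrZ (ger0_norm t0) mulrCA.
  have := ler_wpM2l t0 Lvk; rewrite mulr1; lra.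
by rewrite scale0r subr0.
Qed.

End Lipschitz.

Theorem theorem6 (R : realType) (Y : completeNormedModType R) (A : set Y)
    (k : Y) (A_proper : proper_subset A) (A_closed : closed A)
    (hk : (opp_set (recession_cone A) `\ 0) k) :
  let i := finite_valued (gerstewitz A k) /\ is_lipschitz (gerstewitz A k) in
  let ii := finite_valued (gerstewitz (recession_cone A) k) /\
            is_lipschitz (gerstewitz (recession_cone A) k) in
  let iii := opp_set (interior (recession_cone A)) k in
  ((i <-> ii) /\ (ii <-> iii)) /\
  (iii -> forall L : R,
     lipschitz_constant (gerstewitz (recession_cone A) k) L ->
     lipschitz_constant (gerstewitz A k) L).
Proof.
set C := recession_cone A; move=> i ii iii.
have Ck : C (- k) by case: hk => /opp_setP.
have intC : iii <-> interior C (- k) by apply: opp_setP.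
have cC : closed C by apply: recession_cone_closed.
have CCk : recession_cone C (- k) by rewrite recession_coneK.
have i_iii : i -> iii.
  by case=> _ lip; apply/intC; apply: lipschitz_interior_recession_cone.
have iii_i : iii -> i by move=> /intC; apply: interior_gerstewitz_lipschitz.
have ii_iii : ii -> iii.
  case=> _ lip; apply/intC; rewrite /C -recession_coneK.
  exact: lipschitz_interior_recession_cone.
have iii_ii : iii -> ii.
  move=> /intC intk; apply: interior_gerstewitz_lipschitz => //.
    exact: recession_cone_proper.
  by rewrite recession_coneK.
split; first by split; split; tauto.
move=> /intC intk L lipL; apply: gerstewitz_lipschitz_transfer => //.
  exact: interior_gerstewitz_fin.
exact: lipschitz_constant_cone.
Qed.
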